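(* Let $\mathcal{T}_1$ and $\mathcal{T}_2$ be $d$th-order real tensors of size $n_1\times\cdots\times n_d$. If TR decompositions of these two tensors are $\mathcal{T}_1=\Re(\mathcal{Z}_1,\ldots,\mathcal{Z}_d)$, where $\mathcal{Z}_k\in\mathbb{R}^{r_k\times n_k\times r_{k+1}}$, and $\mathcal{T}_2=\Re(\mathcal{Y}_1,\ldots,\mathcal{Y}_d)$, where $\mathcal{Y}_k\in\mathbb{R}^{s_k\times n_k\times s_{k+1}}$, then the sum $\mathcal{T}_3=\mathcal{T}_1+\mathcal{T}_2$ can also be represented in the TR format as $\mathcal{T}_3=\Re(\mathcal{X}_1,\ldots,\mathcal{X}_d)$, where $\mathcal{X}_k\in\mathbb{R}^{q_k\times n_k\times q_{k+1}}$ and $q_k=r_k+s_k$. Each core $\mathcal{X}_k$ can be computed by $$\mathbf{X}_k(i_k)=\begin{pmatrix}\mathbf{Z}_k(i_k)&0\\0&\mathbf{Y}_k(i_k)\end{pmatrix},\qquad i_k=1,\ldots,n_k,\quad k=1,\ldots,d.$$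
   Context: Tensor ring (TR) decomposition: given cores $\mathcal{Z}_k\in\mathbb{R}^{r_k\times n_k\times r_{k+1}}$, $k=1,\ldots,d$, with $r_{d+1}=r_1$, the notation $\mathcal{T}=\Re(\mathcal{Z}_1,\ldots,\mathcal{Z}_d)$ means that $\mathcal{T}\in\mathbb{R}^{n_1\times\cdots\times n_d}$ and $$T(i_1,\ldots,i_d)=\mathrm{Tr}\{\mathbf{Z}_1(i_1)\mathbf{Z}_2(i_2)\cdots\mathbf{Z}_d(i_d)\}\quad\text{for all } 1\le i_k\le n_k,$$ where $\mathbf{Z}_k(i_k)\in\mathbb{R}^{r_k\times r_{k+1}}$ is the $i_k$th lateral slice of $\mathcal{Z}_k$, i.e. the matrix with entries $\mathcal{Z}_k(\alpha,i_k,\beta)$. The slices $\mathbf{Y}_k(i_k)$ and $\mathbf{X}_k(i_k)$ of $\mathcal{Y}_k$ and $\mathcal{X}_k$ are defined in the same way, with $s_{d+1}=s_1$ and $q_{d+1}=q_1$. *)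

(* Defs.v *)
From mathcomp Require Import all_boot all_order all_algebra reals.
Set Implicit Arguments.
Unset Strict Implicit.
Unset Printing Implicit Defensive.
Import GRing.Theory.
Local Open Scope ring_scope.

(* Positions are 0-based: the mode sizes are [n k] for [k : 'I_d], and the TR
   ranks are [r 0, ..., r d], the ring closing with [r d = r 0].  Only these
   d + 1 values of [r : nat -> nat] are ever used. *)

Definition tensor (R : realType) (d : nat) (n : 'I_d -> nat) : Type :=
  {ffun {dffun forall k : 'I_d, 'I_(n k)} -> R}.

Definition core (R : realType) (p n q : nat) : Type :=
  {ffun 'I_p * 'I_n * 'I_q -> R}.

Definition slice (R : realType) (p n q : nat) (Z : core R p n q) (i : 'I_n) :
  'M[R]_(p, q) := \matrix_(a, b) Z (a, i, b).

(* A 0 *m A 1 *m ... *m A (d - 1) *)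
Fixpoint chain_mulmx (R : realType) (r : nat -> nat) (d : nat) :
    (forall k : 'I_d, 'M[R]_(r k, r k.+1)) -> 'M[R]_(r 0%N, r d) :=
  match d with
  | 0%N => fun=> 1%:M
  | d'.+1 => fun A =>
      chain_mulmx (fun k : 'I_d' => A (widen_ord (leqnSn d') k)) *m A ord_max
  end.

Definition tr_tensor (R : realType) (d : nat) (n : 'I_d -> nat)
    (r : nat -> nat) (hr : r d = r 0%N)
    (Z : forall k : 'I_d, core R (r k) (n k) (r k.+1)) : tensor R n :=
  [ffun i : {dffun forall k : 'I_d, 'I_(n k)} =>
    \tr (castmx (erefl (r 0%N), hr)
          (chain_mulmx (fun k : 'I_d => slice (Z k) (i k))))].

(* Main.v *)
Require Import Defs.
From mathcomp Require Import all_boot all_order all_algebra reals.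
Set Implicit Arguments.
Unset Strict Implicit.
Unset Printing Implicit Defensive.
Import GRing.Theory.
Local Open Scope ring_scope.

(** The block-diagonal matrices form a subalgebra: products and identities of
    [block_mx A 0 0 B] are computed block by block. Hence, at each multi-index,
    the chain of the block-diagonal slices is the block-diagonal matrix of the
    two separate chains ([chain_mulmx_block_diag]). The trace of a
    block-diagonal matrix is the sum of the traces of its blocks, and this
    survives the identification of the last TR rank with the first
    ([mxtrace_castmx_block_diag]), so each entry of the new tensor is the sum of
    the corresponding entries of the two given ones. *)

Lemma eq_chain_mulmx (R : realType) (r : nat -> nat) (d : nat)
    (A B : forall k : 'I_d, 'M[R]_(r k, r k.+1)) :
  (forall k, A k = B k) -> chain_mulmx A = chain_mulmx B.
Proof.
elim: d A B => [//|d IHd] A B eqAB /=.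
congr (_ *m _); last exact: (eqAB ord_max).
by apply: IHd => k; exact: (eqAB (widen_ord (leqnSn d) k)).
Qed.

(** The empty chain is an identity matrix, itself block diagonal, so the
    induction can start from [d = 0]. *)
Lemma chain_mulmx_block_diag (R : realType) (r s : nat -> nat) (d : nat)
    (A : forall k : 'I_d, 'M[R]_(r k, r k.+1))
    (B : forall k : 'I_d, 'M[R]_(s k, s k.+1)) :
  chain_mulmx (r := fun k => (r k + s k)%N)
      (fun k : 'I_d => block_mx (A k) 0 0 (B k))
  = block_mx (chain_mulmx A) 0 0 (chain_mulmx B).
Proof.
elim: d A B => [|d IHd] A B /=; first by rewrite -scalar_mx_block.
rewrite (IHd (fun k => A (widen_ord (leqnSn d) k))
             (fun k => B (widen_ord (leqnSn d) k))).
by rewrite mulmx_block !mulmx0 !mul0mx !addr0 !add0r.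
Qed.

(** The three casts are along unrelated equality proofs; they can all be erased
    because equality proofs between natural numbers are unique. *)
Lemma mxtrace_castmx_block_diag (R : realType) (m1 m2 p1 p2 : nat)
    (e1 : p1 = m1) (e2 : p2 = m2) (e : (p1 + p2 = m1 + m2)%N)
    (A : 'M[R]_(m1, p1)) (B : 'M[R]_(m2, p2)) :
  \tr (castmx (erefl (m1 + m2)%N, e) (block_mx A 0 0 B))
  = \tr (castmx (erefl m1, e1) A) + \tr (castmx (erefl m2, e2) B).
Proof.
case: m1 / e1 e A => e A; case: m2 / e2 e B => e B.
by rewrite (eq_irrelevance e (erefl _)) !castmx_id mxtrace_block.
Qed.

Theorem theorem3 (R : realType) (d : nat) (hd : (0 < d)%N) (n : 'I_d -> nat)
    (T1 T2 : tensor R n)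
    (r s : nat -> nat) (hr : r d = r 0%N) (hs : s d = s 0%N)
    (Z : forall k : 'I_d, core R (r k) (n k) (r k.+1))
    (Y : forall k : 'I_d, core R (s k) (n k) (s k.+1))
    (hT1 : T1 = tr_tensor hr Z) (hT2 : T2 = tr_tensor hs Y) :
  let q := fun k : nat => (r k + s k)%N in
  exists (hq : q d = q 0%N)
         (X : forall k : 'I_d, core R (q k) (n k) (q k.+1)),
    (forall (k : 'I_d) (i : 'I_(n k)),
       slice (X k) i = block_mx (slice (Z k) i) 0 0 (slice (Y k) i)) /\
    T1 + T2 = tr_tensor hq X.
Proof.
move=> q.
have hq : q d = q 0%N by rewrite /q hr hs.
pose X (k : 'I_d) : core R (q k) (n k) (q k.+1) :=
  [ffun u => block_mx (slice (Z k) u.1.2) 0 0 (slice (Y k) u.1.2) u.1.1 u.2].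
have sliceX (k : 'I_d) (i : 'I_(n k)) :
    slice (X k) i = block_mx (slice (Z k) i) 0 0 (slice (Y k) i).
  by apply/matrixP => a b; rewrite mxE ffunE.
exists hq, X; split=> //.
rewrite hT1 hT2; apply/ffunP => i; rewrite !ffunE.
rewrite (eq_chain_mulmx (fun k => sliceX k (i k))) chain_mulmx_block_diag.
by rewrite (mxtrace_castmx_block_diag hr hs).
Qed.
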